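(* Let $\omega>0$, $\kappa>0$ and $p_1,p_2\in(0,1)$. Let $X\sim RBTC(\omega,\kappa,p_1)$ and $Y\sim RBTC(\omega,\kappa,p_2)$, with probability density functions $f(\cdot;\omega,\kappa,p_1)$ and $f(\cdot;\omega,\kappa,p_2)$ respectively. If $p_1<p_2$, then $X$ is less than $Y$ in the likelihood ratio order, that is, the ratio of densities $$x\mapsto \frac{f(x;\omega,\kappa,p_1)}{f(x;\omega,\kappa,p_2)}$$ is decreasing in $x$ on $(0,\infty)$.
   Context: For $\omega>0$, $\kappa>0$ and $p\in(0,1)$, the record-based transmuted Chen distribution $RBTC(\omega,\kappa,p)$ is the probability distribution on $(0,\infty)$ with cumulative distribution function $$F(x;\omega,\kappa,p)=1-\exp\left(\omega(1-e^{x^\kappa})\right)+p\,\omega\,(1-e^{x^\kappa})\exp\left(\omega(1-e^{x^\kappa})\right),\qquad x>0,$$ and probability density function $$f(x;\omega,\kappa,p)=\omega\kappa x^{\kappa-1}\exp\left(\omega(1-e^{x^\kappa})+x^\kappa\right)\left(1-p\,\omega(1-e^{x^\kappa})-p\right),\qquad x>0.$$ The statement $X\sim RBTC(\omega,\kappa,p)$ means that the random variable $X$ has this distribution. *)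

(* Defs.v *)
From HB Require Import structures.
From mathcomp Require Import all_boot all_order all_algebra.
From mathcomp Require Import all_classical all_reals all_analysis.

Set Implicit Arguments.
Unset Strict Implicit.
Unset Printing Implicit Defensive.

Import Order.TTheory GRing.Theory Num.Theory.
Import numFieldNormedType.Exports.

Local Open Scope classical_set_scope.
Local Open Scope ring_scope.

Definition rbtc_cdf (R : realType) (omega kappa p : R) (x : R) : R :=
  if 0 < x then
    1 - expR (omega * (1 - expR (x `^ kappa)))
      + p * omega * (1 - expR (x `^ kappa))
        * expR (omega * (1 - expR (x `^ kappa)))
  else 0.

Definition rbtc_pdf (R : realType) (omega kappa p : R) (x : R) : R :=
  if 0 < x then
    omega * kappa * x `^ (kappa - 1)
      * expR (omega * (1 - expR (x `^ kappa)) + x `^ kappa)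
      * (1 - p * omega * (1 - expR (x `^ kappa)) - p)
  else 0.

Definition has_density (d : measure_display) (T : measurableType d)
    (R : realType) (P : probability T R) (X : {RV P >-> R}) (f : R -> R) : Prop :=
  [/\ measurable_fun setT f,
      forall x, 0 <= f x &
      forall A : set R, measurable A ->
        distribution P X A = (\int[lebesgue_measure]_(x in A) (f x)%:E)%E].

Definition RBTC (d : measure_display) (T : measurableType d) (R : realType)
    (omega kappa p : R) (P : probability T R) (X : {RV P >-> R}) : Prop :=
  (forall x, cdf X x = (rbtc_cdf omega kappa p x)%:E) /\
  has_density X (rbtc_pdf omega kappa p).

(* Densities are only determined almost everywhere, hence the existential.
   The ratio is monotone on the union of the supports of the two densities; it
   is taken in \bar R, where a%:E / 0%:E = +oo for 0 < a. *)
Definition lr_le (d1 d2 : measure_display) (T1 : measurableType d1)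
    (T2 : measurableType d2) (R : realType) (P : probability T1 R)
    (Q : probability T2 R) (X : {RV P >-> R}) (Y : {RV Q >-> R}) : Prop :=
  exists f g : R -> R,
    [/\ has_density X f, has_density Y g &
        forall x y : R, 0 < f x \/ 0 < g x -> 0 < f y \/ 0 < g y -> x <= y ->
          ((f y)%:E / (g y)%:E <= (f x)%:E / (g x)%:E)%E].

(* Main.v *)
(* The densities differ only in the factor 1 - p + p t(x), where
   t(x) = omega (e^(x^kappa) - 1) is positive and increasing in x, so the ratio is
   the Moebius map t |-> (1 - p1 + p1 t) / (1 - p2 + p2 t), of determinant
   p1 (1 - p2) - (1 - p1) p2 = p1 - p2 < 0. *)
Require Import Defs.
From mathcomp Require Import all_boot all_order all_algebra.
From mathcomp Require Import all_classical all_reals all_analysis.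
From mathcomp Require Import ring.

Set Implicit Arguments.
Unset Strict Implicit.
Unset Printing Implicit Defensive.

Import Order.TTheory GRing.Theory Num.Theory.
Import numFieldNormedType.Exports.

Local Open Scope classical_set_scope.
Local Open Scope ring_scope.

Definition chen_cumhazard (R : realType) (omega kappa x : R) : R :=
  omega * (expR (x `^ kappa) - 1).

Lemma chen_cumhazard_gt0 (R : realType) (omega kappa x : R) :
  0 < omega -> 0 < x -> 0 < chen_cumhazard omega kappa x.
Proof.
by move=> w0 x0; rewrite mulr_gt0// subr_gt0 expR_gt1 powR_gt0.
Qed.

Lemma chen_cumhazard_lt (R : realType) (omega kappa x y : R) :
  0 < omega -> 0 < kappa -> 0 < x -> x < y ->
  chen_cumhazard omega kappa x < chen_cumhazard omega kappa y.
Proof.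
move=> w0 k0 x0 xy; rewrite ltr_pM2l// ltrD2r ltr_expR.
by rewrite gt0_ltr_powR// nnegrE ltW// (lt_trans x0).
Qed.

Lemma rbtc_pdfE (R : realType) (omega kappa p x : R) : 0 < x ->
  rbtc_pdf omega kappa p x =
  omega * kappa * x `^ (kappa - 1)
    * expR (omega * (1 - expR (x `^ kappa)) + x `^ kappa)
    * (1 - p + p * chen_cumhazard omega kappa x).
Proof.
by move=> x0; rewrite /rbtc_pdf x0 /chen_cumhazard; congr (_ * _); ring.
Qed.

Lemma rbtc_factor_gt0 (R : realType) (p t : R) :
  0 < p < 1 -> 0 < t -> 0 < 1 - p + p * t.
Proof. by move=> /andP[p0 p1] t0; rewrite addr_gt0 ?subr_gt0 ?mulr_gt0. Qed.

Lemma rbtc_pdf_gt0 (R : realType) (omega kappa p x : R) :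
  0 < omega -> 0 < kappa -> 0 < p < 1 -> 0 < x -> 0 < rbtc_pdf omega kappa p x.
Proof.
move=> w0 k0 p01 x0; rewrite rbtc_pdfE// mulr_gt0 ?rbtc_factor_gt0 ?chen_cumhazard_gt0//.
by rewrite !mulr_gt0 ?powR_gt0 ?expR_gt0.
Qed.

(** Turns the support conditions in [lr_le] into the positivity that the ratio lemmas require. *)
Lemma rbtc_pdf_supp (R : realType) (omega kappa p x : R) :
  0 < rbtc_pdf omega kappa p x -> 0 < x.
Proof. by rewrite /rbtc_pdf; case: ifP => // _; rewrite ltxx. Qed.

(** The factor that does not involve [p] is a product of positive terms on the half-line, so it
    cancels. *)
Lemma rbtc_pdf_ratio (R : realType) (omega kappa p1 p2 x : R) :
  0 < omega -> 0 < kappa -> 0 < x ->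
  rbtc_pdf omega kappa p1 x / rbtc_pdf omega kappa p2 x =
  (1 - p1 + p1 * chen_cumhazard omega kappa x) /
  (1 - p2 + p2 * chen_cumhazard omega kappa x).
Proof.
move=> w0 k0 x0; rewrite !rbtc_pdfE// -mulf_div divff ?mul1r//.
by rewrite gt_eqF// !mulr_gt0 ?powR_gt0 ?expR_gt0.
Qed.

Lemma rbtc_pdf_ratio_lt (R : realType) (omega kappa p1 p2 x y : R) :
  0 < omega -> 0 < kappa -> 0 < p2 < 1 -> p1 < p2 -> 0 < x -> x < y ->
  rbtc_pdf omega kappa p1 y / rbtc_pdf omega kappa p2 y <
  rbtc_pdf omega kappa p1 x / rbtc_pdf omega kappa p2 x.
Proof.
move=> w0 k0 p201 p12 x0 xy; have y0 := lt_trans x0 xy.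
rewrite !rbtc_pdf_ratio//.
have sx := chen_cumhazard_gt0 kappa w0 x0; have sy := chen_cumhazard_gt0 kappa w0 y0.
(* Both denominators are positive, so cross-multiplication leaves a polynomial inequality in the two
   cumulative hazards. *)
rewrite ltr_pdivrMr ?rbtc_factor_gt0// mulrAC ltr_pdivlMr ?rbtc_factor_gt0//.
have st := chen_cumhazard_lt w0 k0 x0 xy.
rewrite -subr_gt0.
set s := chen_cumhazard _ _ x in st *; set t := chen_cumhazard _ _ y in st *.
(* The constant terms and the [s * t] terms cancel; what remains is minus the Moebius determinant
   times the increment of the hazard. *)
have -> : (1 - p1 + p1 * s) * (1 - p2 + p2 * t)
    - (1 - p1 + p1 * t) * (1 - p2 + p2 * s) = (p2 - p1) * (t - s) by ring.
by rewrite mulr_gt0 ?subr_gt0.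
Qed.

(** Inversion in [\bar R] agrees with real inversion on finite nonzero arguments; only at 0 do they
    differ ([+oo] against 0), and positive denominators exclude that case. *)
Lemma lee_div_EFin (R : realType) (a b c d : R) :
  0 < b -> 0 < d -> a / b <= c / d -> (a%:E / b%:E <= c%:E / d%:E)%E.
Proof. by move=> b0 d0; rewrite !inver !gt_eqF// -!EFinM lee_fin. Qed.

Theorem theorem2 (R : realType) (d1 d2 : measure_display)
    (T1 : measurableType d1) (T2 : measurableType d2)
    (P : probability T1 R) (Q : probability T2 R)
    (X : {RV P >-> R}) (Y : {RV Q >-> R})
    (omega kappa p1 p2 : R)
    (homega : 0 < omega) (hkappa : 0 < kappa)
    (hp1 : 0 < p1 < 1) (hp2 : 0 < p2 < 1)
    (hX : RBTC omega kappa p1 X) (hY : RBTC omega kappa p2 Y)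
    (hp12 : p1 < p2) :
  lr_le X Y /\
  (forall x y : R, 0 < x -> x < y ->
     rbtc_pdf omega kappa p1 y / rbtc_pdf omega kappa p2 y <
     rbtc_pdf omega kappa p1 x / rbtc_pdf omega kappa p2 x).
Proof.
have ratio_lt x y := @rbtc_pdf_ratio_lt R omega kappa p1 p2 x y
  homega hkappa hp2 hp12.
split; last exact: ratio_lt.
case: hX hY => _ densX [_ densY].
exists (rbtc_pdf omega kappa p1), (rbtc_pdf omega kappa p2); split; [exact: densX|exact: densY|] => x y.
(* At equal points the inequality is reflexivity, which leaves the strict case. *)
move=> fgx _; rewrite le_eqVlt => /predU1P[->//|xy].
have x0 : 0 < x by case: fgx => /rbtc_pdf_supp.
have y0 := lt_trans x0 xy.
apply: lee_div_EFin; [exact: rbtc_pdf_gt0|exact: rbtc_pdf_gt0|].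
exact/ltW/ratio_lt.
Qed.
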